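(* Let $T,N\in\mathbb N$ and let $\mu^1,\dots,\mu^N$ be Borel probability measures on $\mathbb R^T$ such that for each $i$ the canonical process $X^i$ is an $(\mathbb F^i,\mu^i)$-martingale and the market consisting of $X^i$ is complete. Let $\pi\in\mathrm{Cpl}(\mu^1,\dots,\mu^N)$. Then $\pi$ satisfies condition (NA) if and only if $\pi\in\mathrm{Cpl}_{\mathrm{mc}}(\mu^1,\dots,\mu^N)$.
   Context: $X^i=(X^i_t)_{t=1}^T$ is the canonical process on $\mathbb R^T$, $\mathbb F^i=(\mathcal F^i_t)$ its canonical filtration, with $\mathcal F^i_0$ trivial. Set $X^i_0:=x^i_0:=\mathbb E^{\mu^i}[X^i_1]$. Completeness of the market consisting of $X^i$: for every $(\mathbb F^i,\mu^i)$-martingale $M^i$ there is an $\mathbb F^i$-adapted real process $\Delta^i=(\Delta^i_t)_{t=0}^{T-1}$ with $M^i_t=m^i_0+\sum_{s=1}^t\Delta^i_{s-1}(X^i_s-X^i_{s-1})$ $\mu^i$-a.s. for all $t\in\{0,\dots,T\}$, where $M^i_0=m^i_0:=\mathbb E^{\mu^i}[M^i_1]$. $\mathrm{Cpl}(\mu^1,\dots,\mu^N)$ is the set of Borel probability measures on $(\mathbb R^T)^N$ with marginals $\mu^1,\dots,\mu^N$. Condition (NA) for $\pi$: the $\mathbb R^N$-valued canonical process $\mathbf X=(X^1,\dots,X^N)$ on $\mathbb R^{T\cdot N}$ is an $(\mathbb F^{\mathbf X},\pi)$-martingale, where $\mathbb F^{\mathbf X}$ is the filtration generated by $\mathbf X$.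 $\pi$ is multicausal, $\pi\in\mathrm{Cpl}_{\mathrm{mc}}(\mu^1,\dots,\mu^N)$, if for every $i\in\{1,\dots,N\}$ and $t\in\{1,\dots,T\}$, under $\pi$, $(X^i_1,\dots,X^i_T)$ is independent of $\{(X^j_1,\dots,X^j_t):j\ne i\}$ given $(X^i_1,\dots,X^i_t)$. *)

(* Defs.v *)
From HB Require Import structures.
From mathcomp Require Import all_boot all_order all_algebra.
From mathcomp Require Import all_classical all_reals all_analysis.

Set Implicit Arguments.
Unset Strict Implicit.
Unset Printing Implicit Defensive.

Import Order.TTheory GRing.Theory Num.Theory.

Local Open Scope classical_set_scope.
Local Open Scope ring_scope.

(* The sigma-algebra on Omega generated by the real functions X j, j \in J;
   it is {set0, setT} when J is empty. *)
Definition sigma_gen (I Omega : Type) (R : realType) (J : set I)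
    (X : I -> Omega -> R) : set (set Omega) :=
  <<s \bigcup_(j in J) preimage_set_system setT (X j) measurable >>.

(* Measurability with respect to a (sub-)sigma-algebra G of Omega. *)
Definition measurable_wrt (Omega : Type) (R : realType)
    (G : set (set Omega)) (Y : Omega -> R) : Prop :=
  preimage_set_system setT Y measurable `<=` G.

(* Z is a version of the conditional expectation E^P[Y | G]. *)
Definition is_condexp (d : measure_display) (Omega : measurableType d)
    (R : realType) (P : probability Omega R) (G : set (set Omega))
    (Y Z : Omega -> R) : Prop :=
  [/\ measurable_wrt G Z,
      P.-integrable setT (EFin \o Z) &
      forall A, G A -> (\int[P]_(w in A) (Z w)%:E = \int[P]_(w in A) (Y w)%:E)%E].

(* (M t), t = 1, ..., T, is an (F, P)-martingale; only the values F t and M t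
   for 1 <= t <= T are constrained. *)
Definition martingale (d : measure_display) (Omega : measurableType d)
    (R : realType) (P : probability Omega R) (T : nat)
    (F : nat -> set (set Omega)) (M : nat -> Omega -> R) : Prop :=
  [/\ forall t, (1 <= t <= T)%N -> measurable_wrt (F t) (M t),
      forall t, (1 <= t <= T)%N -> P.-integrable setT (EFin \o M t) &
      forall t, (1 <= t < T)%N -> is_condexp P (F t) (M t.+1) (M t)].

(* The sigma-algebras F and G are independent given H under P:
   P(A `&` B | H) = P(A | H) P(B | H) a.s. for all A in F and B in G.  Versions
   of conditional probabilities exist and are a.s. unique, so that the choice
   of f and g is immaterial. *)
Definition cond_independent (d : measure_display) (Omega : measurableType d)
    (R : realType) (P : probability Omega R) (F G H : set (set Omega)) : Prop :=
  forall A B, F A -> G B ->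
    exists f g : Omega -> R,
      [/\ is_condexp P H \1_A f, is_condexp P H \1_B g &
          is_condexp P H \1_(A `&` B) (f \* g)].

(* Extends a process indexed by t = 1, ..., T to t = 0 by M_0 := E^P[M_1]. *)
Definition with_initial (d : measure_display) (Omega : measurableType d)
    (R : realType) (P : probability Omega R) (M : nat -> Omega -> R)
    (t : nat) : Omega -> R :=
  if t is 0 then fun=> fine 'E_P[M 1%N] else M t.

(* The canonical process on R^T, with times 1, ..., T: the entries of a tuple
   are numbered from 0. *)
Definition coord_process (R : realType) (T t : nat) (x : T.-tuple R) : R := x`_t.-1.

Definition coord_filtration (R : realType) (T t : nat) :
    set (set (T.-tuple R)) :=
  sigma_gen [set s | (1 <= s <= t)%N] (@coord_process R T).

Definition complete_market (R : realType) (T : nat)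
    (mu : probability (T.-tuple R) R) : Prop :=
  forall M : nat -> T.-tuple R -> R,
    martingale mu T (@coord_filtration R T) M ->
    exists Delta : nat -> T.-tuple R -> R,
      (forall t, (t < T)%N -> measurable_wrt (@coord_filtration R T t) (Delta t)) /\
      (forall t, (t <= T)%N ->
        {ae mu, forall x,
          with_initial mu M t x =
          fine 'E_mu[M 1%N] +
          \sum_(1 <= s < t.+1) Delta s.-1 x *
            (with_initial mu (@coord_process R T) s x -
             with_initial mu (@coord_process R T) s.-1 x)}).

(* (R^T)^N is N.-tuple (T.-tuple R), with the product sigma-algebra, which is
   the Borel one. *)
Definition joint_process (R : realType) (T N : nat) (i : 'I_N) (t : nat)
    (w : N.-tuple (T.-tuple R)) : R := coord_process t (tnth w i).

(* The sigma-algebra generated by the X^j_s with j \in J and 1 <= s <= t. *)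
Definition joint_sigma (R : realType) (T N : nat) (J : set 'I_N) (t : nat) :
    set (set (N.-tuple (T.-tuple R))) :=
  sigma_gen [set p : 'I_N * nat | J p.1 /\ (1 <= p.2 <= t)%N]
    (fun p => @joint_process R T N p.1 p.2).

Definition coupling (R : realType) (T N : nat)
    (mu : 'I_N -> probability (T.-tuple R) R)
    (pi : probability (N.-tuple (T.-tuple R)) R) : Prop :=
  forall (i : 'I_N) (A : set (T.-tuple R)), measurable A ->
    pushforward pi (fun w => tnth w i) A = mu i A.

(* An R^N-valued process is a martingale when each of its components is one
   for the common filtration. *)
Definition NA (R : realType) (T N : nat)
    (pi : probability (N.-tuple (T.-tuple R)) R) : Prop :=
  forall i : 'I_N, martingale pi T (@joint_sigma R T N setT) (@joint_process R T N i).

Definition multicausal (R : realType) (T N : nat)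
    (mu : 'I_N -> probability (T.-tuple R) R)
    (pi : probability (N.-tuple (T.-tuple R)) R) : Prop :=
  coupling mu pi /\
  forall (i : 'I_N) (t : nat), (1 <= t <= T)%N ->
    cond_independent pi (@joint_sigma R T N [set i] T)
      (@joint_sigma R T N [set j | j != i] t)
      (@joint_sigma R T N [set i] t).

(* Main.v *)
Require Import Defs.
From HB Require Import structures.
From mathcomp Require Import all_boot all_order all_algebra.
From mathcomp Require Import all_classical all_reals all_analysis.
From mathcomp Require Import finmap measurable_realfun.

Set Implicit Arguments.
Unset Strict Implicit.
Unset Printing Implicit Defensive.

(** The equivalence comes from one observation: whether X^i is a martingale for
the joint filtration, and whether pi is multicausal, are both statements that
knowing the past of the other components does not change a conditional
expectation of a function of X^i given the past of X^i.  Write F^i_t for the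
sigma-algebra of X^i up to time t, F_t for that of all the components up to t,
and A for an event of F^i_T.

From (NA) to multicausality.  Let M_t be a version of P(A | F^i_t), a bounded
martingale.  By completeness its increments are Delta_t (X^i_{t+1} - X^i_t) a.s.
with Delta_t measurable for F^i_t, hence for F_t.  Since X^i is a martingale for
(F_t), so is M, by [martingale_transform]: the products of Delta with the
increments are integrable because they are increments of M.  As M_T is the
indicator of A, this gives P(A | F_t) = M_t = P(A | F^i_t), and multicausality
follows by [cond_independentP].

From multicausality to (NA).  Let B be an event of the other components up to t.
Conditional independence gives a [0, 1]-valued g that is a version of both
P(B | F^i_t) and P(B | F^i_T), see [cond_independent_indic].  The increment
V = X^i_{t+1} - X^i_t is measurable for F^i_T and integrates to 0 on the events
of F^i_t, so for every C in F^i_t the integral of V on B `&` C is that of V g on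
C, which is 0.  The events B `&` C form a pi-system that generates F_t, so X^i is a
martingale for (F_t), see [condexp_cond_independent].

The measure theory that both directions rest on is the rule for taking a known
factor out of a conditional expectation ([integral_mul_eq0], [condexp_mul]), the
existence of conditional probabilities with values in [0, 1] ([condexp_indic]),
and the transport of conditional expectations from R^T to the product space
along a projection ([condexp_comp]). *)

Import Order.TTheory GRing.Theory Num.Theory.
Import numFieldNormedType.Exports HBNNSimple.

Local Open Scope classical_set_scope.
Local Open Scope ring_scope.

(** * Measurability with respect to a sub-sigma-algebra *)

Definition sigma_subalgebra d (Omega : measurableType d)
    (G : set (set Omega)) :=
  sigma_algebra setT G /\ G `<=` measurable.

Section measurable_wrt_theory.
Context d (Omega : measurableType d) (R : realType).
Implicit Types (G H : set (set Omega)) (Y : Omega -> R) (A : set Omega).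

(** Turns a sub-sigma-algebra into a measurable space, so that the closure
properties of measurable functions apply to [measurable_wrt]. *)
Lemma measurable_wrtP G Y : sigma_algebra setT G ->
  measurable_wrt G Y <->
  measurable_fun setT (Y : g_sigma_algebraType G -> R).
Proof.
move=> sG; split=> [mY _ B mB|mY _ [B mB <-]].
  by rewrite measurable_g_measurableTypeE//; apply: mY; exists B.
by have := mY measurableT B mB; rewrite measurable_g_measurableTypeE.
Qed.

Lemma measurable_wrt_sub G H Y : G `<=` H ->
  measurable_wrt G Y -> measurable_wrt H Y.
Proof. by move=> GH mY A /mY /GH. Qed.

Lemma measurable_wrt_fun G Y : G `<=` measurable ->
  measurable_wrt G Y -> measurable_fun setT Y.
Proof. by move=> Gm mY _ B mB; apply: Gm; apply: mY; exists B. Qed.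

Lemma measurable_wrtM G Y Z : sigma_algebra setT G ->
  measurable_wrt G Y -> measurable_wrt G Z -> measurable_wrt G (Y \* Z).
Proof.
move=> sG /(measurable_wrtP _ sG) mY /(measurable_wrtP _ sG) mZ.
by apply/(measurable_wrtP _ sG); exact: measurable_funM.
Qed.

Lemma measurable_wrt_indic G A : sigma_algebra setT G ->
  G A -> measurable_wrt G (\1_A : Omega -> R).
Proof.
move=> sG GA; apply/(measurable_wrtP _ sG).
apply: (@measurable_indic _ (g_sigma_algebraType G)).
by rewrite measurable_g_measurableTypeE.
Qed.

Lemma sigma_algebra_setT G : sigma_algebra setT G -> G setT.
Proof. by case=> G0 GC _; rewrite -(setD0 setT); exact: GC. Qed.

Lemma sigma_algebraI G A B : sigma_algebra setT G -> G A -> G B -> G (A `&` B).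
Proof.
move=> sG; rewrite -(measurable_g_measurableTypeE sG).
exact: measurableI.
Qed.

End measurable_wrt_theory.

(** * Taking out what is known *)

Section integral_zero_on_sub_sigma.
Context d (Omega : measurableType d) (R : realType) (P : probability Omega R).
Variables (G : set (set Omega)) (Z : Omega -> R).
Hypotheses (sG : sigma_subalgebra G) (iZ : P.-integrable setT (EFin \o Z)).
Hypothesis Z0 : forall A, G A -> (\int[P]_(w in A) (Z w)%:E = 0)%E.

(* The level sets of a G-simple function h are in G, so the integral of h Z is a
   combination of integrals of Z over sets of G. *)
Let integral_nnsfun_mul0 (h : {nnsfun (g_sigma_algebraType G) >-> R}) A :
  G A -> (\int[P]_(w in A) (h w * Z w)%:E = 0)%E.
Proof.
move=> GA; have mA := sG.2 _ GA.
have mh y : G (h @^-1` [set y]).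
  have := measurable_funPTI h (measurable_set1 y).
  by rewrite measurable_g_measurableTypeE//; exact: sG.1.
have E w : (h w * Z w)%:E =
   (\sum_(y <- fset_set (range h))
      y%:E * ((EFin \o Z) \_ (h @^-1` [set y]) w))%E.
  rewrite fimfunE fsbig_finite//= mulr_suml -sumEFin; apply: eq_bigr => y _.
  rewrite -mulrA [RHS]/= EFinM; congr (_ * _)%E.
  by rewrite epatch_indic muleC /= -EFinM.
under eq_integral do rewrite E.
have iZy y : P.-integrable A ((EFin \o Z) \_ (h @^-1` [set y])).
  apply: (integrable_restrict _ _ _ _).1 => //; first exact: sG.2.
  by apply: integrableS iZ => //; apply: measurableI => //; exact: sG.2.
rewrite integral_sum//=; last by move=> y; apply: integrableZl.
rewrite big1// => y _; rewrite integralZl// -integral_mkcondr.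
by rewrite Z0 ?mule0//; apply: sigma_algebraI => //; exact: sG.1.
Qed.

(* The products with Z of the simple functions that increase to Y are dominated
   by Y Z, which is why the integrability that is asked for is that of Y Z. *)
Let ge0_integral_mul0 (Y : Omega -> R) A : measurable_wrt G Y ->
  (forall w, 0 <= Y w) -> P.-integrable setT (EFin \o (Y \* Z)) ->
  G A -> (\int[P]_(w in A) (Y w * Z w)%:E = 0)%E.
Proof.
move=> mY Y0 iYZ GA; have mA := sG.2 _ GA.
have mY' : measurable_fun [set: g_sigma_algebraType G] (EFin \o Y).
  by apply/measurable_EFinP; exact/measurable_wrtP/mY/sG.1.
pose h n : {nnsfun (g_sigma_algebraType G) >-> R} :=
  nnsfun_approx measurableT mY' n.
have Y0' (x : g_sigma_algebraType G) : setT x -> (0 <= (EFin \o Y) x)%E.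
  by move=> _; rewrite lee_fin.
have hY w : (h n w)%:E @[n --> \oo] --> (Y w)%:E.
  exact: (cvg_nnsfun_approx measurableT mY' Y0').
have hleY n w : h n w <= Y w.
  have nd : {homo (fun m => h m w) : m k / (m <= k)%N >-> m <= k}.
    by move=> m k mk; have /lefP := nd_nnsfun_approx measurableT mY' mk; exact.
  have /fine_cvgP[_ hYR] := hY w.
  have <- := cvg_lim (@Rhausdorff R) hYR.
  by apply: (nondecreasing_cvgn_le nd); apply/cvg_ex; exists (Y w).
have mZ := measurable_int P iZ.
have mhZ n : measurable_fun [set: Omega] (fun w : Omega => (h n w * Z w)%:E).
  apply/measurable_EFinP; apply: measurable_funM; last exact/measurable_EFinP.
  move=> _ B mB; apply: sG.2.
  have := measurable_funPTI (h n) mB.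
  by rewrite measurable_g_measurableTypeE ?setTI//; exact: sG.1.
have cvg_hZ : {ae P, forall w, A w ->
    (h n w * Z w)%:E @[n --> \oo] --> (Y w * Z w)%:E}.
  apply: aeW => w _; under eq_fun do rewrite EFinM.
  by rewrite EFinM; apply: cvgeZr => //; exact: hY.
have hZ_le : {ae P, forall w n, A w ->
    (`|(h n w * Z w)%:E| <= `|(Y w * Z w)%:E|)%E}.
  apply: aeW => w n _; rewrite !abse_EFin lee_fin !normrM ler_wpM2r//.
  by rewrite !ger0_norm.
have iAYZ : P.-integrable A (fun w => `|(Y w * Z w)%:E|)%E.
  by apply: integrable_abse; exact: integrableS iYZ.
have [_ _] := dominated_convergence mA (fun n => measurable_funTS (mhZ n))
  (measurable_funTS (measurable_int P iYZ)) cvg_hZ iAYZ hZ_le.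
rewrite [X in X @ _](_ : _ = cst 0%E); last first.
  by apply/funext => n /=; exact: integral_nnsfun_mul0.
by move=> /(cvg_lim (@ereal_hausdorff R)) <-; rewrite lim_cst.
Qed.

(** This is E(Y Z | G) = Y E(Z | G) in the case where the last factor is 0; the
general rule [condexp_mul] follows by a difference. *)
Lemma integral_mul_eq0 (Y : Omega -> R) A : measurable_wrt G Y ->
  P.-integrable setT (EFin \o (Y \* Z)) ->
  G A -> (\int[P]_(w in A) (Y w * Z w)%:E = 0)%E.
Proof.
move=> mY iYZ GA; have mA := sG.2 _ GA.
have mYG := (measurable_wrtP _ sG.1).1 mY.
have mYp : measurable_wrt G Y^\+.
  by apply/(measurable_wrtP _ sG.1); exact: measurable_funrpos.
have mYn : measurable_wrt G Y^\-.
  by apply/(measurable_wrtP _ sG.1); exact: measurable_funrneg.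
have iW (W : Omega -> R) : measurable_wrt G W -> (forall w, `|W w| <= `|Y w|) ->
    P.-integrable setT (EFin \o (W \* Z)).
  move=> mW WY; apply: (le_integrable _ _ _ iYZ) => //.
    apply/measurable_EFinP/measurable_funM.
      exact: measurable_wrt_fun sG.2 mW.
    exact/measurable_EFinP/(measurable_int P iZ).
  by move=> w _; rewrite !abse_EFin lee_fin !normrM ler_wpM2r.
have YE w : `|Y w| = Y^\+ w + Y^\- w.
  by have := congr1 (@^~ w) (funrposDneg Y).
have iYpZ : P.-integrable setT (EFin \o (Y^\+ \* Z)).
  by apply: iW => // w; rewrite ger0_norm ?funrpos_ge0// YE lerDl funrneg_ge0.
have iYnZ : P.-integrable setT (EFin \o (Y^\- \* Z)).
  by apply: iW => // w; rewrite ger0_norm ?funrneg_ge0// YE lerDr funrpos_ge0.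
rewrite (eq_integral (fun w => (Y^\+ w * Z w)%:E - (Y^\- w * Z w)%:E)%E).
  rewrite integralB_EFin//; [|exact: integrableS iYpZ|exact: integrableS iYnZ].
  by rewrite !ge0_integral_mul0 ?sube0// => w;
    rewrite ?funrpos_ge0 ?funrneg_ge0.
by move=> w _; rewrite -EFinB -mulrBl -[in LHS](funrposBneg Y).
Qed.

End integral_zero_on_sub_sigma.

(** * Conditional expectations and conditional probabilities *)

Section restriction_to_sub_sigma.
Context d (Omega : measurableType d) (R : realType).
Variables (P : {finite_measure set Omega -> \bar R}) (G : set (set Omega)).
Hypothesis sG : sigma_subalgebra G.

(** The same set function, seen as a measure on the smaller measurable space.
The proof is an argument because the measure structure depends on it. *)
Definition restrict_sigma of sigma_subalgebra G :
  set (g_sigma_algebraType G) -> \bar R := P.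

Let Gmeasurable (A : set (g_sigma_algebraType G)) :
  measurable A -> d.-measurable (A : set Omega).
Proof. by rewrite measurable_g_measurableTypeE; [exact: sG.2|exact: sG.1]. Qed.

Let restrict_sigma0 : restrict_sigma sG set0 = 0%E.
Proof. exact: measure0. Qed.

Let restrict_sigma_ge0 A : (0 <= restrict_sigma sG A)%E.
Proof. exact: measure_ge0. Qed.

Let restrict_sigma_additive : semi_sigma_additive (restrict_sigma sG).
Proof.
move=> F mF tF mUF; apply: (@measure_semi_sigma_additive _ _ _ P) => //.
- by move=> n; exact: Gmeasurable.
- exact: Gmeasurable.
Qed.

HB.instance Definition _ := isMeasure.Build _ _ _ (restrict_sigma sG)
  restrict_sigma0 restrict_sigma_ge0 restrict_sigma_additive.

Let fin_num_restrict_sigma : fin_num_fun (restrict_sigma sG).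
Proof. by move=> A mA; apply: fin_num_measure; exact: Gmeasurable. Qed.

HB.instance Definition _ :=
  @Measure_isFinite.Build _ _ _ (restrict_sigma sG) fin_num_restrict_sigma.

Lemma ge0_integral_restrict_sigma (f : Omega -> \bar R) A :
  measurable_fun setT (f : g_sigma_algebraType G -> \bar R) ->
  (forall w, (0 <= f w)%E) -> G A ->
  (\int[restrict_sigma sG]_(w in A) f w = \int[P]_(w in A) f w)%E.
Proof.
move=> mf f0 GA.
have mid : measurable_fun setT (id : Omega -> g_sigma_algebraType G).
  by move=> _ B /Gmeasurable mB; rewrite setTI.
rewrite -(ge0_integral_pushforward mid P (D := A) (f := f))//.
- by rewrite measurable_g_measurableTypeE//; exact: sG.1.
- exact: measurable_funTS.
Qed.

End restriction_to_sub_sigma.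

Section condexp_theory.
Context d (Omega : measurableType d) (R : realType) (P : probability Omega R).
Implicit Types (G : set (set Omega)) (Y Z W : Omega -> R) (A B : set Omega).

Lemma indic_01 A w : 0 <= (\1_A w : R) <= 1.
Proof. by rewrite indicE; case: (_ \in _); rewrite ?lexx ler01. Qed.

Lemma integrable_01 Y : measurable_fun setT Y ->
  (forall w, 0 <= Y w <= 1) -> P.-integrable setT (EFin \o Y).
Proof.
move=> mY Y01; apply: measurable_bounded_integrable => //.
  by apply: le_lt_trans (probability_le1 P measurableT) _; rewrite ltry.
exists 1; split=> [|x x1 w _]; first exact: num_real.
by have /andP[Y0 Y1] := Y01 w; rewrite /= ger0_norm// (le_trans Y1)// ltW.
Qed.

Lemma integrableM_01 Y W : P.-integrable setT (EFin \o Y) ->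
  measurable_fun setT W -> (forall w, 0 <= W w <= 1) ->
  P.-integrable setT (EFin \o (Y \* W)).
Proof.
move=> iY mW W01; apply: (le_integrable _ _ _ iY) => //.
  apply/measurable_EFinP/measurable_funM => //.
  exact/measurable_EFinP/(measurable_int P iY).
move=> w _; have /andP[W0 W1] := W01 w.
by rewrite !abse_EFin lee_fin normrM ler_piMr// ger0_norm.
Qed.

Lemma integral_mul_indic Y A B :
  (\int[P]_(w in A) (Y w * \1_B w)%:E = \int[P]_(w in A `&` B) (Y w)%:E)%E.
Proof.
rewrite integral_mkcondr; apply: eq_integral => w _.
by rewrite epatch_indic /= -EFinM.
Qed.

Lemma integrable_sub Y Z : P.-integrable setT (EFin \o Y) ->
  P.-integrable setT (EFin \o Z) -> P.-integrable setT (EFin \o (Y \- Z)).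
Proof.
by move=> iY iZ; apply: eq_integrable (integrableB measurableT iY iZ).
Qed.

Lemma integral_sub_eq0 Y Z A : measurable A ->
  P.-integrable setT (EFin \o Y) -> P.-integrable setT (EFin \o Z) ->
  (\int[P]_(w in A) ((Y \- Z) w)%:E = 0)%E <->
  (\int[P]_(w in A) (Y w)%:E = \int[P]_(w in A) (Z w)%:E)%E.
Proof.
move=> mA iY iZ.
have iYA : P.-integrable A (EFin \o Y) by exact: integrableS iY.
have iZA : P.-integrable A (EFin \o Z) by exact: integrableS iZ.
under eq_integral do rewrite EFinB.
rewrite integralB_EFin//; split=> [/eqP|->]; last first.
  by rewrite subee ?integrable_fin_num.
by rewrite sube_eq ?fin_num_adde_defr ?integrable_fin_num// add0e => /eqP.
Qed.

(** The rule E(W Y | G) = W E(Y | G), from [integral_mul_eq0] for Z - Y. *)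
Lemma condexp_mul G Y Z W A : sigma_subalgebra G ->
  P.-integrable setT (EFin \o Y) -> is_condexp P G Y Z ->
  measurable_wrt G W ->
  P.-integrable setT (EFin \o (W \* Y)) ->
  P.-integrable setT (EFin \o (W \* Z)) ->
  G A ->
  (\int[P]_(w in A) (W w * Z w)%:E = \int[P]_(w in A) (W w * Y w)%:E)%E.
Proof.
move=> sG iY [mZ iZ YZ] mW iWY iWZ GA.
have mulB w : W w * (Z \- Y) w = (W \* Z \- W \* Y) w by rewrite /= mulrBr.
apply/(integral_sub_eq0 (sG.2 _ GA) iWZ iWY).
rewrite (eq_integral (fun w => (W w * (Z \- Y) w)%:E)); last first.
  by move=> w _; rewrite mulB.
apply: integral_mul_eq0 GA => //; first exact: integrable_sub.
  by move=> B GB; apply/integral_sub_eq0; rewrite ?YZ//; exact: sG.2.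
rewrite (_ : _ \o _ = EFin \o (W \* Z \- W \* Y)); first exact: integrable_sub.
by apply/funext => w /=; rewrite mulrBr.
Qed.

(** A version of P(B | G) is the Radon-Nikodym derivative of P(_ `&` B) with
respect to P on G, truncated at 1.  The truncation keeps the integrals: on the
set D where the derivative f exceeds 1, the integral of f over A `&` D is
P(A `&` D `&` B), which is at most P(A `&` D), the integral of 1. *)
Lemma condexp_indic G B : sigma_subalgebra G -> measurable B ->
  exists g : Omega -> R, is_condexp P G \1_B g /\ forall w, 0 <= g w <= 1.
Proof.
move=> sG mB.
pose mu : {finite_measure set (g_sigma_algebraType G) -> \bar R} :=
  restrict_sigma P sG.
pose nu : {finite_measure set (g_sigma_algebraType G) -> \bar R} :=
  restrict_sigma (mrestr P mB) sG.
have numu : nu `<< mu.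
  apply/null_content_dominatesP => A.
  rewrite measurable_g_measurableTypeE; last exact: sG.1.
  move=> /sG.2 mA PA0; apply/eqP; rewrite eq_le measure_ge0 andbT -PA0.
  by apply: (@le_measure _ _ _ P); [exact/mem_set/measurableI|exact/mem_set|].
have [f [f0 /integrableP[mf _] fE]] := radon_nikodym_finite numu.
have fPE A : G A -> (\int[P]_(w in A) f w = P (A `&` B))%E.
  move=> GA; rewrite -(ge0_integral_restrict_sigma P sG)//.
  by rewrite -fE// measurable_g_measurableTypeE//; exact: sG.1.
pose m (w : Omega) := mine (f w) 1%E.
have m0 w : (0 <= m w)%E by rewrite le_min f0 lee01.
have m1 w : (m w <= 1)%E by rewrite ge_min lexx orbT.
have mG : measurable_fun [set: g_sigma_algebraType G] m.
  by apply: measurable_mine => //; exact: measurable_cst.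
have fineG : measurable_wrt G (fine \o m).
  by apply/(measurable_wrtP _ sG.1); exact: measurableT_comp.
have fin_m w : m w \is a fin_num.
  by rewrite ge0_fin_numE// (le_lt_trans (m1 w))// ltry.
have g01 w : 0 <= (fine \o m) w <= 1.
  by rewrite -!lee_fin fineK// m0 m1.
exists (fine \o m); split=> //; split=> //.
  by apply: integrable_01; first exact: measurable_wrt_fun sG.2 fineG.
move=> A GA; have mA := sG.2 _ GA.
transitivity (\int[P]_(w in A) f w)%E; last first.
  by rewrite integral_indic// setIC; exact: fPE.
under eq_integral do rewrite fineK//.
have mfO : measurable_fun [set: Omega] f.
  move=> _ U mU; apply: sG.2; have := mf measurableT U mU.
  by rewrite measurable_g_measurableTypeE//; exact: sG.1.
have mmO : measurable_fun [set: Omega] m.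
  by apply: measurable_mine => //; exact: measurable_cst.
apply/eqP; rewrite eq_le; apply/andP; split.
  apply: ge0_le_integral => //; [exact: measurable_funTS..|].
  by move=> w _; rewrite ge_min lexx.
pose D := [set w | (1 < f w)%E].
have GD : G D.
  have := emeasurable_fun_o_infty measurableT mf 1%E.
  by rewrite setTI measurable_g_measurableTypeE//; exact: sG.1.
have GAD : G (A `&` D) by apply: sigma_algebraI => //; exact: sG.1.
have mD := sG.2 _ GD.
have AE : A = (A `\` D) `|` (A `&` D) by rewrite setUC setUIDK.
have dAD : [disjoint A `\` D & A `&` D].
  apply/disj_setPRL => w [_ Dw] [_]; exact.
have mAD := sG.2 _ GAD.
have mADc : measurable (A `\` D) by exact: measurableD.
rewrite AE !ge0_integral_setU//; do ?exact: measurable_funTS.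
apply: leeD.
  rewrite (eq_integral m)// => w /set_mem[_ /negP].
  by rewrite -leNgt => fw; rewrite /m min_l.
rewrite fPE//.
have -> : (\int[P]_(w in A `&` D) m w = P (A `&` D))%E.
  rewrite (eq_integral (cst 1%E)); first by rewrite integral_cst// mul1e.
  by move=> w /set_mem[_ /ltW fw]; rewrite /m min_r.
by apply: (@le_measure _ _ _ P); [exact/mem_set/measurableI|exact/mem_set|].
Qed.

End condexp_theory.

(** * Martingales and conditional independence *)

Section more_condexp.
Context d (Omega : measurableType d) (R : realType) (P : probability Omega R).
Implicit Types (F G H K S : set (set Omega)) (Y Z W : Omega -> R).

(** The measurable sets on which Z integrates to 0 form a Dynkin system, because
the integral over the whole space is 0. *)
Lemma integral_eq0_generated S Z : setI_closed S -> S setT ->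
  S `<=` measurable -> P.-integrable setT (EFin \o Z) ->
  (forall A, S A -> (\int[P]_(w in A) (Z w)%:E = 0)%E) ->
  forall A, <<s S >> A -> (\int[P]_(w in A) (Z w)%:E = 0)%E.
Proof.
move=> SI ST Sm iZ Z0 A.
rewrite -setI_closed_g_dynkin_g_sigma_algebra//.
pose D : set (set Omega) :=
  [set A | measurable A /\ (\int[P]_(w in A) (Z w)%:E = 0)%E].
suff SD : <<d S >> `<=` D by move=> /SD[].
have iZS B : measurable B -> P.-integrable B (EFin \o Z).
  by move=> mB; exact: integrableS iZ.
apply: smallest_sub; last by move=> B SB; split; [exact: Sm|exact: Z0].
split.
- by split=> //; exact: Z0.
- move=> B [mB B0]; split; first exact: measurableC.
  have := Z0 _ ST; rewrite -(setvU B) integral_setU//.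
  + by rewrite B0 adde0.
  + exact: measurableC.
  + by rewrite setvU; exact: measurable_int iZ.
  + exact/disj_setPCr.
- move=> B tB mB0; have mB n := (mB0 n).1.
  split; first exact: bigcupT_measurable.
  rewrite integral_bigcup//; last exact/iZS/bigcupT_measurable.
  by rewrite eseries0// => n _ _; exact: (mB0 n).2.
Qed.

Lemma condexp_tower G H Y Z W : sigma_subalgebra G -> G `<=` H ->
  is_condexp P H Y W -> is_condexp P G Y Z -> is_condexp P G W Z.
Proof.
move=> sG GH [_ _ YW] [mZ iZ YZ]; split=> // A GA.
by rewrite YZ// YW//; exact: GH.
Qed.

Lemma martingale_integral (T : nat) (F : nat -> set (set Omega))
    (M : nat -> Omega -> R) :
  {homo F : s t / (s <= t)%N >-> s `<=` t} -> martingale P T F M ->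
  forall s t A, (1 <= s <= t)%N -> (t <= T)%N -> F s A ->
  (\int[P]_(w in A) (M s w)%:E = \int[P]_(w in A) (M t w)%:E)%E.
Proof.
move=> Fmono [_ _ MM] s t A /andP[s1]; elim: t => [|t IH].
  by move: s1; case: s.
rewrite leq_eqVlt => /predU1P[->//|]; rewrite ltnS => st tT FA.
have t1 := leq_trans s1 st.
rewrite IH//; last exact: ltnW.
have [|_ _ ->//] := MM t; first by rewrite t1.
exact: Fmono st _ FA.
Qed.

(** The conditional probabilities of A; at time T the version is the indicator
itself rather than a function a.s. equal to it, so that later equalities at the
final time hold everywhere. *)
Lemma indic_martingale (T : nat) (F : nat -> set (set Omega)) A :
  (forall t, sigma_subalgebra (F t)) ->
  {homo F : s t / (s <= t)%N >-> s `<=` t} -> F T A ->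
  exists M : nat -> Omega -> R,
    [/\ martingale P T F M, M T = \1_A & forall t w, 0 <= M t w <= 1].
Proof.
move=> sF Fmono FA; have mA := (sF T).2 _ FA.
have /choice[M HM] : forall t, exists m : Omega -> R,
    [/\ (t <= T)%N -> is_condexp P (F t) \1_A m, t = T -> m = \1_A &
        forall w, 0 <= m w <= 1].
  move=> t; have [->|/eqP tT] := eqVneq t T.
    exists \1_A; split=> // [_|w]; last exact: indic_01.
    split=> //; first by apply: measurable_wrt_indic => //; exact: (sF T).1.
    exact: integrable_indic.
  by have [m [? ?]] := condexp_indic P (sF t) mA; exists m; split.
exists M; split=> [|//|t]; last by have [_ _] := HM t.
- split=> t /andP[t1 tT]; have [Mt _ _] := HM t.
  + by have [] := Mt tT.
  + by have [] := Mt tT.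
  + have [Mt1 _ _] := HM t.+1.
    by apply: condexp_tower (Mt1 tT) (Mt (ltnW tT)) => //; exact: Fmono.
- by have [_ ->] := HM T.
Qed.

Lemma integrable_ae_eq Y Z : measurable_fun setT Y ->
  {ae P, forall w, Y w = Z w} -> P.-integrable setT (EFin \o Z) ->
  P.-integrable setT (EFin \o Y).
Proof.
move=> mY YZ /integrableP[mZ fZ]; apply/integrableP; split.
  exact/measurable_EFinP.
rewrite (ae_eq_integral (abse \o (EFin \o Z)))//.
- by apply: measurableT_comp => //; exact/measurable_EFinP.
- exact: measurableT_comp.
- by apply: filterS YZ => w /= -> _.
Qed.

(** On a set of F t the product of Delta t with the increment of X integrates to
0 by [integral_mul_eq0].  The lemma moves a stochastic integral M from the
filtration of one component to the joint one.  Completeness says nothing about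
the integrability of Delta, hence the hypothesis on that of M. *)
Lemma martingale_transform (T : nat) (F : nat -> set (set Omega))
    (X M Delta : nat -> Omega -> R) :
  (forall t, sigma_subalgebra (F t)) -> martingale P T F X ->
  (forall t, (1 <= t <= T)%N -> measurable_wrt (F t) (M t)) ->
  (forall t, (1 <= t <= T)%N -> P.-integrable setT (EFin \o M t)) ->
  (forall t, (1 <= t < T)%N -> measurable_wrt (F t) (Delta t)) ->
  (forall t, (1 <= t < T)%N -> {ae P, forall w,
     Delta t w * (X t.+1 w - X t w) = M t.+1 w - M t w}) ->
  martingale P T F M.
Proof.
move=> sF [_ iX XX] mM iM mDelta MDelta; split=> // t /andP[t1 tT].
have tT' : (1 <= t <= T)%N by rewrite t1 ltnW.
have tT1 : (1 <= t.+1 <= T)%N by [].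
have t1T : (1 <= t < T)%N by rewrite t1.
split; [exact: mM|exact: iM|move=> A FA].
have mA := (sF t).2 _ FA.
pose Z := X t.+1 \- X t.
have iZ : P.-integrable setT (EFin \o Z) by apply: integrable_sub; exact: iX.
have iN : P.-integrable setT (EFin \o (M t.+1 \- M t)).
  by apply: integrable_sub; exact: iM.
have Z0 B : F t B -> (\int[P]_(w in B) (Z w)%:E = 0)%E.
  move=> FB; have [_ _ XB] := XX _ t1T.
  by apply/integral_sub_eq0; rewrite ?XB//; [exact: (sF t).2|exact: iX..].
have mDZ : measurable_fun setT (Delta t \* Z).
  apply: measurable_funM; last exact/measurable_EFinP/(measurable_int P iZ).
  exact: measurable_wrt_fun (sF t).2 (mDelta _ t1T).
have iDZ : P.-integrable setT (EFin \o (Delta t \* Z)).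
  exact: integrable_ae_eq mDZ (MDelta _ t1T) iN.
have := integral_mul_eq0 (sF t) iZ Z0 (mDelta _ t1T) iDZ FA.
rewrite (ae_eq_integral (EFin \o (M t.+1 \- M t)))//; first last.
- by apply: filterS (MDelta _ t1T) => w /= <- _.
- exact/measurable_funTS/(measurable_int P iN).
- exact/measurable_funTS/measurable_EFinP.
by move=> /integral_sub_eq0 -> //; exact: iM.
Qed.

(** Let f be a version of P(A | K) that is measurable for H and g one of
P(B | H).  On C in H the integral of f g is that of f \1_B, that is, of f over
C `&` B, which is P(A `&` B `&` C) since C `&` B is in K. *)
Lemma cond_independentP F G H K : sigma_subalgebra H -> sigma_subalgebra K ->
  G `<=` K -> H `<=` K -> F `<=` measurable ->
  (forall A, F A -> exists f : Omega -> R,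
     [/\ measurable_wrt H f, forall w, 0 <= f w <= 1 &
         is_condexp P K \1_A f]) ->
  cond_independent P F G H.
Proof.
move=> sH sK GK HK Fm HF A B FA GB.
have mA := Fm _ FA; have KB := GK _ GB; have mB := sK.2 _ KB.
have [f [mf f01 [_ iF Af]]] := HF _ FA.
have [g [cg g01]] := condexp_indic P sH mB.
have [mg ig Bg] := cg.
have fm := measurable_wrt_fun sH.2 mf.
have ifg : P.-integrable setT (EFin \o (f \* g)).
  by apply: integrableM_01 => //; exact: measurable_wrt_fun sH.2 mg.
have ifB : P.-integrable setT (EFin \o (f \* \1_B)).
  by apply: integrableM_01 => // w; exact: indic_01.
exists f, g; split=> //.
  by split=> // C HC; exact/Af/HK.
split=> //; first exact: measurable_wrtM sH.1 mf mg.
move=> C HC; have mC := sH.2 _ HC.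
rewrite /= (condexp_mul sH _ cg mf ifB ifg HC)//; last exact: integrable_indic.
rewrite integral_mul_indic Af; last first.
  by apply: sigma_algebraI sK.1 _ KB; exact: HK.
by rewrite !integral_indic// ?setIA; [rewrite setIAC|exact: measurableI..].
Qed.

(** Conditional independence seen from the other side: once H is known, F tells
nothing more about B.  The versions f and h provided by the hypothesis depend on
the event A as well as on B, whereas g has to be chosen before A and bounded;
the integral of f h is therefore compared with that of f g through that of
f \1_B. *)
Lemma cond_independent_indic F G H B :
  sigma_subalgebra F -> sigma_subalgebra H ->
  G `<=` measurable -> H `<=` F -> cond_independent P F G H -> G B ->
  exists g : Omega -> R, [/\ forall w, 0 <= g w <= 1,
    is_condexp P H \1_B g & is_condexp P F \1_B g].
Proof.
move=> sF sH Gm HF FGH GB; have mB := Gm _ GB.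
have [g [cg g01]] := condexp_indic P sH mB.
have [mg ig Bg] := cg; exists g; split=> //; split=> //.
  exact: measurable_wrt_sub mg.
move=> A FA; have mA := sF.2 _ FA.
have [f [h [cf ch [_ ifh Ah]]]] := FGH A B FA GB.
have [mf if_ Af] := cf.
have HT := sigma_algebra_setT sH.1.
have iind C : measurable C ->
    P.-integrable setT (EFin \o (\1_C : Omega -> R)).
  by move=> mC; exact: integrable_indic.
have mgO := measurable_wrt_fun sH.2 mg.
have ifB : P.-integrable setT (EFin \o (f \* \1_B)).
  by apply: integrableM_01 => // w; exact: indic_01.
have ifg : P.-integrable setT (EFin \o (f \* g)) by exact: integrableM_01.
have igA : P.-integrable setT (EFin \o (g \* \1_A)).
  by apply: integrableM_01 => // w; exact: indic_01.
have igf : P.-integrable setT (EFin \o (g \* f)).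
  by apply: eq_integrable ifg => // w _; rewrite /= mulrC.
transitivity (\int[P]_w (g w * \1_A w)%:E)%E.
  by rewrite integral_mul_indic setTI.
rewrite -(condexp_mul sH (iind _ mA) cf mg igA igf HT).
under eq_integral do rewrite mulrC.
rewrite (condexp_mul sH (iind _ mB) cg mf ifB ifg HT).
rewrite -(condexp_mul sH (iind _ mB) ch mf ifB ifh HT).
by rewrite Ah// !integral_indic//; [rewrite setIT setIC|exact: measurableI].
Qed.

(** By the pi-lambda theorem it is enough to integrate V = Y - Z over B `&` C, with
B in G and C in H.  There the indicator of B can be replaced by its conditional
probability g given F, since V is measurable for F; as g is measurable for H and
V has zero conditional expectation given H, the integral is 0. *)
Lemma condexp_cond_independent F G H K Y Z :
  sigma_subalgebra F -> sigma_subalgebra G -> sigma_subalgebra H ->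
  H `<=` F -> H `<=` K ->
  K `<=` <<s [set B `&` C | B in G & C in H] >> ->
  cond_independent P F G H -> measurable_wrt F Y ->
  P.-integrable setT (EFin \o Y) -> is_condexp P H Y Z -> is_condexp P K Y Z.
Proof.
move=> sF sG sH HF HK KGH FGH mY iY [mZ iZ YZ].
split=> //; first exact: measurable_wrt_sub mZ.
pose V := Y \- Z.
have iV : P.-integrable setT (EFin \o V) by exact: integrable_sub.
have VH C : H C -> (\int[P]_(w in C) (V w)%:E = 0)%E.
  by move=> HC; apply/integral_sub_eq0; rewrite ?YZ//; exact: sH.2.
have mV : measurable_wrt F V.
  apply/(measurable_wrtP _ sF.1); apply: measurable_funB.
    exact/(measurable_wrtP _ sF.1).
  by apply/(measurable_wrtP _ sF.1); exact: measurable_wrt_sub mZ.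
pose S := [set B `&` C | B in G & C in H].
have GT := sigma_algebra_setT sG.1.
have HT := sigma_algebra_setT sH.1.
have SI : setI_closed S.
  move=> _ _ [B1 GB1 [C1 HC1 <-]] [B2 GB2 [C2 HC2 <-]].
  exists (B1 `&` B2); first exact: sigma_algebraI sG.1 _ _.
  exists (C1 `&` C2); first exact: sigma_algebraI sH.1 _ _.
  by rewrite setIACA.
have ST : S setT by exists setT => //; exists setT => //; rewrite setIT.
have Sm : S `<=` measurable.
  by move=> _ [B /sG.2 mB [C /sH.2 mC <-]]; exact: measurableI.
suff VS A : S A -> (\int[P]_(w in A) (V w)%:E = 0)%E.
  move=> A KA; apply/esym/integral_sub_eq0 => //.
    have sS : <<s S >> `<=` measurable.
      exact: smallest_sub (@sigma_algebra_measurable _ Omega) Sm.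
    exact: sS _ (KGH _ KA).
  exact: (integral_eq0_generated SI ST Sm iV VS) (KGH _ KA).
move=> [B GB [C HC <-]]; have mB := sG.2 _ GB; have mC := sH.2 _ HC.
have [g [g01 [mg ig _] cgF]] :=
  cond_independent_indic sF sH sG.2 HF FGH GB.
have mgO := measurable_wrt_fun sH.2 mg.
have iVB : P.-integrable setT (EFin \o (V \* \1_B)).
  by apply: integrableM_01 => // w; exact: indic_01.
have iVg : P.-integrable setT (EFin \o (V \* g)) by exact: integrableM_01.
rewrite setIC -integral_mul_indic.
rewrite -(condexp_mul sF _ cgF mV iVB iVg);
  [|exact: integrable_indic|exact: HF].
under eq_integral do rewrite mulrC.
apply: (integral_mul_eq0 sH iV VH mg) => //.
by apply: eq_integrable iVg => // w _; rewrite /= mulrC.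
Qed.

End more_condexp.

(** * Transport along a measure-preserving map *)

Section image_measure.
Context d1 d2 (Omega1 : measurableType d1) (Omega2 : measurableType d2).
Context (R : realType) (P : probability Omega1 R) (Q : probability Omega2 R).
Variable phi : Omega1 -> Omega2.
Hypotheses (mphi : measurable_fun setT phi)
  (Pphi : forall A, measurable A -> pushforward P phi A = Q A).
Implicit Types (G : set (set Omega2)) (Y Z : Omega2 -> R).

Lemma measurable_wrt_comp G Y : measurable_wrt G Y ->
  measurable_wrt (preimage_set_system setT phi G) (Y \o phi).
Proof.
move=> mY _ [B mB <-]; exists (Y @^-1` B); last by rewrite comp_preimage.
by apply: mY; exists B => //; rewrite setTI.
Qed.

Lemma integrable_comp Y : Q.-integrable setT (EFin \o Y) ->
  P.-integrable setT (EFin \o (Y \o phi)).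
Proof.
move=> /integrableP[mY iY]; apply/integrableP; split.
  exact: measurableT_comp mY mphi.
suff <- : (\int[Q]_x `|(EFin \o Y) x| =
           \int[P]_w `|(EFin \o (Y \o phi)) w|)%E by [].
rewrite -(ge0_integral_pushforward mphi P (D := setT)
  (f := fun x => `|(EFin \o Y) x|%E))//; last exact: measurableT_comp.
by apply: eq_measure_integral => A mA _; exact/esym/Pphi.
Qed.

Lemma integral_comp Y A : measurable A -> Q.-integrable setT (EFin \o Y) ->
  (\int[P]_(w in phi @^-1` A) (Y (phi w))%:E = \int[Q]_(x in A) (Y x)%:E)%E.
Proof.
move=> mA iY.
have iYphi : P.-integrable (phi @^-1` A) ((EFin \o Y) \o phi).
  apply: integrableS (integrable_comp iY) => //.
  by rewrite -[X in measurable X]setTI; exact: mphi.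
rewrite -(integral_pushforward mphi (measurable_int Q iY) iYphi mA).
by apply: eq_measure_integral => B mB _; exact: Pphi.
Qed.

Lemma condexp_comp G Y Z : G `<=` measurable ->
  Q.-integrable setT (EFin \o Y) -> is_condexp Q G Y Z ->
  is_condexp P (preimage_set_system setT phi G) (Y \o phi) (Z \o phi).
Proof.
move=> Gm iY [mZ iZ YZ]; split.
- exact: measurable_wrt_comp.
- exact: integrable_comp.
- move=> _ [A GA <-]; rewrite setTI !integral_comp//; [exact: YZ|exact: Gm..].
Qed.

Lemma ae_comp (p : Omega2 -> Prop) :
  {ae Q, forall x, p x} -> {ae P, forall w, p (phi w)}.
Proof.
move=> [A [mA QA0 pA]]; exists (phi @^-1` A); split.
- by rewrite -[X in measurable X]setTI; exact: mphi.
- by have := Pphi mA; rewrite QA0.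
- by move=> w /= npw; apply: pA.
Qed.

End image_measure.

(** * The canonical filtrations on one component *)

Section complete_market_theory.
Context (R : realType) (T : nat).

(* After time T the index exceeds the length of the tuple and the coordinate is
   the default value 0. *)
Lemma measurable_coord_process t :
  measurable_fun setT (@coord_process R T t).
Proof.
have [tT|tT] := ltnP t.-1 T.
  rewrite (_ : coord_process t = fun x => tnth x (Ordinal tT)).
    exact: measurable_tnth.
  by apply/funext => x; rewrite /coord_process (tnth_nth 0).
rewrite (_ : coord_process t = cst 0); first exact: measurable_cst.
by apply/funext => x; rewrite /coord_process nth_default// size_tuple.
Qed.

Lemma sigma_subalgebra_gen d (Omega : measurableType d) I (J : set I)
    (X : I -> Omega -> R) : (forall j, measurable_fun setT (X j)) ->
  sigma_subalgebra (sigma_gen J X).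
Proof.
move=> mX; split; first exact: smallest_sigma_algebra.
apply: smallest_sub; first exact: sigma_algebra_measurable.
by move=> _ [j _ [B mB <-]]; exact: mX.
Qed.

Lemma sigma_gen_mono (Omega I : Type) (J K : set I) (X : I -> Omega -> R) :
  J `<=` K -> sigma_gen J X `<=` sigma_gen K X.
Proof. by move=> JK; apply: sub_sigma_algebra2; exact: bigcup_subset. Qed.

Lemma sigma_subalgebra_coord t : sigma_subalgebra (@coord_filtration R T t).
Proof.
by apply: sigma_subalgebra_gen => s; exact: measurable_coord_process.
Qed.

Lemma coord_filtration_mono :
  {homo @coord_filtration R T : s t / (s <= t)%N >-> s `<=` t}.
Proof.
move=> s t st; apply: sigma_gen_mono => u /= /andP[-> /=].
by move=> /leq_trans; exact.
Qed.

(** The representations at times t.+1 and t differ by one term of the stochastic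
integral, and at positive times [with_initial] is the process itself. *)
Lemma complete_market_increments (mu : probability (T.-tuple R) R)
    (M : nat -> T.-tuple R -> R) :
  complete_market mu -> martingale mu T (@coord_filtration R T) M ->
  exists Delta : nat -> T.-tuple R -> R, forall t, (1 <= t < T)%N ->
    measurable_wrt (@coord_filtration R T t) (Delta t) /\
    {ae mu, forall x, Delta t x * (coord_process t.+1 x - coord_process t x) =
                      M t.+1 x - M t x}.
Proof.
move=> mu_complete /mu_complete[Delta [mDelta reprM]]; exists Delta.
move=> t /andP[t1 tT]; split; first exact: mDelta.
apply: filterS2 (reprM _ tT) (reprM _ (ltnW tT)) => x.
rewrite big_nat_recr//=; case: t t1 {tT} => // t _ /= -> ->.
by rewrite [in RHS]addrA [RHS]addrC addKr.
Qed.

End complete_market_theory.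

(** * The filtrations on the product space *)

Section joint_sigma_theory.
Context (R : realType) (T N : nat).
Implicit Types (J K : set 'I_N) (i : 'I_N).

Lemma measurable_joint_process i t :
  measurable_fun setT (@joint_process R T N i t).
Proof.
exact: measurableT_comp (@measurable_coord_process R T t) (measurable_tnth i).
Qed.

Lemma sigma_subalgebra_joint J t : sigma_subalgebra (@joint_sigma R T N J t).
Proof.
by apply: sigma_subalgebra_gen => p; exact: measurable_joint_process.
Qed.

Lemma joint_sigma_mono J K s t : J `<=` K -> (s <= t)%N ->
  @joint_sigma R T N J s `<=` @joint_sigma R T N K t.
Proof.
move=> JK st; apply: sigma_gen_mono => -[i u] /= [/JK Ki /andP[u1 us]].
by split=> //; rewrite u1 (leq_trans us).
Qed.

Lemma joint_sigma1 i t : @joint_sigma R T N [set i] t =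
  preimage_set_system setT (fun w => tnth w i) (@coord_filtration R T t).
Proof.
rewrite /coord_filtration.
rewrite -(g_sigma_preimageE setT (fun w : N.-tuple _ => tnth w i)).
congr <<s _ >>; apply/seteqP; split.
  move=> _ [[j s] [/= -> st] [B mB <-]].
  exists (@coord_process R T s @^-1` B); last by rewrite !setTI.
  by exists s => //; exists B => //; rewrite setTI.
move=> _ [_ [s st [B mB <-]] <-]; exists (i, s) => //; exists B => //.
by rewrite !setTI.
Qed.

Lemma joint_sigma_split i t : @joint_sigma R T N setT t `<=`
  <<s [set B `&` C | B in @joint_sigma R T N [set j | j != i] t &
                     C in @joint_sigma R T N [set i] t] >>.
Proof.
apply: sub_sigma_algebra2 => A [[j s] /= [_ st] XA].
have genA J : J j -> @joint_sigma R T N J t A.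
  by move=> Jj; apply: sub_sigma_algebra; exists (j, s).
have setT_joint J := sigma_algebra_setT (sigma_subalgebra_joint J t).1.
have [ji|ji] := eqVneq j i.
  by exists setT => //; exists A; [exact: genA|rewrite setTI].
by exists A; [exact: genA|exists setT => //; rewrite setIT].
Qed.

End joint_sigma_theory.

(** * The two implications *)

Section coupling_theory.
Context (R : realType) (T N : nat) (mu : 'I_N -> probability (T.-tuple R) R).
Context (pi : probability (N.-tuple (T.-tuple R)) R).
Hypotheses (mu_martingale : forall i : 'I_N,
    martingale (mu i) T (@coord_filtration R T) (@coord_process R T))
  (pi_coupling : coupling mu pi).

Let mtnth i : measurable_fun setT (fun w : N.-tuple (T.-tuple R) => tnth w i).
Proof. exact: measurable_tnth. Qed.

Lemma NA_multicausal : (forall i, complete_market (mu i)) ->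
  NA pi -> multicausal mu pi.
Proof.
move=> mu_complete pi_NA; split=> // i t /andP[t1 tT].
have sK u : sigma_subalgebra (@joint_sigma R T N setT u).
  exact: sigma_subalgebra_joint.
have Kmono : {homo @joint_sigma R T N setT : u v / (u <= v)%N >-> u `<=` v}.
  by move=> u v uv; exact: joint_sigma_mono.
apply: (@cond_independentP _ _ _ _ _ _ _ (@joint_sigma R T N setT t)) => //.
- exact: sigma_subalgebra_joint.
- exact: joint_sigma_mono.
- exact: joint_sigma_mono.
- exact: (sigma_subalgebra_joint R T [set i] T).2.
rewrite joint_sigma1 => _ [A FA <-]; rewrite setTI.
have [M [martM MT M01]] := indic_martingale (mu i)
  (@sigma_subalgebra_coord R T) (@coord_filtration_mono R T) FA.
have [Delta HDelta] := complete_market_increments (mu_complete i) martM.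
have [mM iM _] := martM.
pose Mi u (w : N.-tuple (T.-tuple R)) := M u (tnth w i).
have up J u (Y : T.-tuple R -> R) : J i ->
    measurable_wrt (@coord_filtration R T u) Y ->
    measurable_wrt (@joint_sigma R T N J u) (fun w => Y (tnth w i)).
  move=> Ji mY.
  have := measurable_wrt_comp (phi := fun w : N.-tuple _ => tnth w i) mY.
  rewrite -joint_sigma1; apply: measurable_wrt_sub.
  by apply: joint_sigma_mono => // _ ->.
have martMi : martingale pi T (@joint_sigma R T N setT) Mi.
  apply: (martingale_transform (X := @joint_process R T N i)
      (Delta := fun u w => Delta u (tnth w i))) => //.
  - by move=> u uT; apply: up => //; exact: mM.
  - move=> u uT; apply: (integrable_comp (mtnth i) (pi_coupling i)).
    exact: iM.
  - by move=> u uT; apply: up => //; exact: (HDelta u uT).1.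
  - by move=> u uT; exact: (ae_comp (mtnth i) (pi_coupling i) (HDelta u uT).2).
have tT' : (1 <= t <= T)%N by rewrite t1.
exists (Mi t); split; [by apply: up => //; exact: mM|by move=> w; exact: M01|].
split.
- by apply: up => //; exact: mM.
- by have [_ + _] := martMi; apply.
- move=> B KB; rewrite (martingale_integral Kmono martMi (t := T))//.
  by apply: eq_integral => w _; rewrite /Mi MT !indicE.
Qed.

Lemma multicausal_NA : multicausal mu pi -> NA pi.
Proof.
move=> [_ pi_mc] i; have [mX iX XX] := mu_martingale i.
have up u : (1 <= u <= T)%N ->
    measurable_wrt (@joint_sigma R T N [set i] u) (@joint_process R T N i u).
  by move=> uT; rewrite joint_sigma1; apply: measurable_wrt_comp; exact: mX.
have iXi u : (1 <= u <= T)%N ->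
    pi.-integrable setT (EFin \o @joint_process R T N i u).
  by move=> uT; apply: (integrable_comp (mtnth i) (pi_coupling i)); exact: iX.
split=> // t => [tT|/andP[t1 tT]].
  by apply: measurable_wrt_sub (up t tT); exact: joint_sigma_mono.
have tT' : (1 <= t <= T)%N by rewrite t1 ltnW.
have tT1 : (1 <= t.+1 <= T)%N by [].
have t1T : (1 <= t < T)%N by rewrite t1.
apply: (condexp_cond_independent (sigma_subalgebra_joint R T _ _)
  (sigma_subalgebra_joint R T _ _) (sigma_subalgebra_joint R T _ _)
  _ _ _ (pi_mc i t tT')).
- by apply: joint_sigma_mono => //; exact: ltnW.
- exact: joint_sigma_mono.
- exact: joint_sigma_split.
- by apply: measurable_wrt_sub (up _ tT1); exact: joint_sigma_mono.
- exact: iXi.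
- rewrite joint_sigma1.
  apply: (condexp_comp (mtnth i) (pi_coupling i)); last exact: XX.
    exact: (sigma_subalgebra_coord R T t).2.
  exact: iX.
Qed.

End coupling_theory.

Theorem proposition3p3 (R : realType) (T N : nat) (T_gt0 : (0 < T)%N)
    (N_gt0 : (0 < N)%N)
    (mu : 'I_N -> probability (T.-tuple R) R)
    (mu_martingale : forall i : 'I_N,
       martingale (mu i) T (@coord_filtration R T) (@coord_process R T))
    (mu_complete : forall i : 'I_N, complete_market (mu i))
    (pi : probability (N.-tuple (T.-tuple R)) R)
    (pi_coupling : coupling mu pi) :
  NA pi <-> multicausal mu pi.
Proof.
split; first exact: NA_multicausal.
exact: multicausal_NA.
Qed.
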